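(* There are exactly $8$ varieties of CI-groupoids that are defined, relative to the variety of all CI-groupoids, by a single additional identity of Bol-Moufang type.
   Context: A groupoid is a set with one binary operation, written as juxtaposition. A CI-groupoid is a groupoid whose operation is commutative and idempotent ($xy\approx yx$, $xx\approx x$). A groupoid identity $p\approx q$ is of Bol-Moufang type if: (i) the same 3 variables appear in $p$ and $q$; (ii) one of the variables appears twice in both $p$ and $q$; (iii) the remaining two variables appear once in each of $p$ and $q$; (iv) the variables appear in the same order in $p$ and $q$. (For example, $x(x(yz))\approx (x(xy))z$.) The variety of CI-groupoids defined by such an identity is the class of all CI-groupoids satisfying it; varieties are counted as classes, so that two identities satisfied by the same CI-groupoids define the same variety. *)

(* Defs.v *)
From mathcomp Require Import all_boot.
From mathcomp Require Import boolp classical_sets functions cardinality.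

Set Implicit Arguments.
Unset Strict Implicit.
Unset Printing Implicit Defensive.

(* The library's [magmaType] cannot be used here: its universe is constrained
   to be strictly above that of [set], so [set magmaType] is ill-typed. *)
Record groupoid : Type := Groupoid {
  carrier :> Type;
  op : carrier -> carrier -> carrier
}.

Definition CI_groupoid (G : groupoid) : Prop :=
  commutative (@op G) /\ idempotent_op (@op G).

(* Groupoid terms over the variables 0, 1, 2, ... *)
Inductive term : Type :=
| Var of nat
| App of term & term.

Fixpoint eval (G : groupoid) (v : nat -> G) (t : term) : G :=
  match t with
  | Var i => v i
  | App t1 t2 => op (eval v t1) (eval v t2)
  end.

(* The variable occurrences of a term, with repetitions, from left to right. *)
Fixpoint word (t : term) : seq nat :=
  match t with
  | Var i => [:: i]
  | App t1 t2 => word t1 ++ word t2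
  end.

(* [(p, q)] stands for the formal identity p = q. *)
Definition identity : Type := (term * term)%type.

Definition satisfies (G : groupoid) (e : identity) : Prop :=
  forall v : nat -> G, eval v e.1 = eval v e.2.

(* Here x is the repeated variable; the four conditions after [uniq] are:
   same three variables, x twice, y and z once each, same order. *)
Definition bol_moufang (e : identity) : Prop :=
  exists x y z : nat,
    [/\ uniq [:: x; y; z],
        word e.1 =i [:: x; y; z] /\ word e.2 =i [:: x; y; z],
        count_mem x (word e.1) = 2 /\ count_mem x (word e.2) = 2,
        [/\ count_mem y (word e.1) = 1, count_mem z (word e.1) = 1,
            count_mem y (word e.2) = 1 & count_mem z (word e.2) = 1]
      & word e.1 = word e.2].

Definition CI_variety (e : identity) : set groupoid :=
  [set G | CI_groupoid G /\ satisfies G e]%classic.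

(* A set of classes, so identities with the same CI-models count once. *)
Definition CI_varieties_bol_moufang : set (set groupoid) :=
  [set CI_variety e | e in [set e | bol_moufang e]]%classic.

(* Main.v *)
Require Import Defs.
From HB Require Import structures.
From mathcomp Require Import all_boot.
From mathcomp Require Import boolp classical_sets functions cardinality.

Set Implicit Arguments.
Unset Strict Implicit.
Unset Printing Implicit Defensive.

(** Over the variables 0, 1, 2, with 0 the repeated one, a Bol-Moufang identity
    is a pair of bracketings of one of the 12 rearrangements of 0012, so there
    are 300 of them.  Commutativity, idempotence, exchange of the two sides and
    exchange of the variables 1 and 2 leave only the identities listed in
    [classification]; that each of the 300 reduces to a listed one is a finite
    computation ([classified]).  The eight rows of that list are:

    - the identities that hold in every CI-groupoid;
    - those that force associativity ([associativity_laws]).  Conversely, a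
      semigroup satisfies every identity whose two sides have the same word.
      Most of the laws yield [x(xy) = xy] after one identification of
      variables, and associativity follows from it;
    - [x((xy)z) = (x(xy))z], which already contains [x(xy) = xy];
    - four rows, each with a single law up to the symmetries above;
    - the 2-semilattice law [x(xy) = xy] ([two_semilattice_laws]).

    Hence there are at most eight varieties.  Six finite CI-groupoids tell
    the eight rows apart ([classification_separated]).  Five of them have at
    most four elements; the sixth, of order 6, separates
    [(x(xy))z = (x(xz))y] from the stronger law [x(x(yz)) = (x(xy))z]. *)

Local Notation X := (Var 0).
Local Notation Y := (Var 1).
Local Notation Z := (Var 2).
Local Notation "s ∘ t" := (App s t) (at level 40, left associativity).

(** * Terms and renaming of variables *)

Fixpoint term_eqb (s t : term) : bool :=
  match s, t with
  | Var i, Var j => i == j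
  | s1 ∘ s2, t1 ∘ t2 => term_eqb s1 t1 && term_eqb s2 t2
  | _, _ => false
  end.

Lemma term_eqP : Equality.axiom term_eqb.
Proof.
elim=> [i|s1 IH1 s2 IH2] [j|t1 t2] /=; try by constructor.
  by apply: (iffP eqP) => [->|[]].
by apply: (iffP andP) => [[/IH1-> /IH2->]|[<- <-]] //; split; [apply/IH1|apply/IH2].
Qed.

HB.instance Definition _ := hasDecEq.Build term term_eqP.

Fixpoint rename (f : nat -> nat) (t : term) : term :=
  match t with
  | Var i => Var (f i)
  | t1 ∘ t2 => rename f t1 ∘ rename f t2
  end.

Definition rename_identity (f : nat -> nat) (e : identity) : identity :=
  (rename f e.1, rename f e.2).

Definition variables (e : identity) : seq nat := word e.1 ++ word e.2.

Lemma eval_rename (G : groupoid) (v : nat -> G) f t :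
  eval v (rename f t) = eval (v \o f) t.
Proof. by elim: t => //= t1 -> t2 ->. Qed.

Lemma word_rename f t : word (rename f t) = map f (word t).
Proof. by elim: t => //= t1 -> t2 ->; rewrite map_cat. Qed.

Lemma eq_in_eval (G : groupoid) (v w : nat -> G) t :
  {in word t, v =1 w} -> eval v t = eval w t.
Proof.
elim: t => [i|t1 IH1 t2 IH2] /= vw; first by apply: vw; rewrite inE.
by rewrite IH1 ?IH2 // => i it; apply: vw; rewrite mem_cat it ?orbT.
Qed.

Lemma eval_congr (G : groupoid) (v w : nat -> G) e :
  {in variables e, v =1 w} ->
  (eval v e.1 = eval w e.1) * (eval v e.2 = eval w e.2).
Proof.
by move=> vw; split; apply: eq_in_eval => i it; apply: vw; rewrite mem_cat it ?orbT.
Qed.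

(** Only injectivity of the renaming on the variables that occur matters, so
    the same lemma serves to rename an identity to the variables 0, 1, 2 and to
    exchange 1 and 2. *)
Lemma satisfies_rename (G : groupoid) (f g : nat -> nat) e :
  {in variables e, cancel f g} ->
  satisfies G (rename_identity f e) <-> satisfies G e.
Proof.
move=> fK; split=> sat v; last by rewrite !eval_rename; apply: sat.
have := sat (v \o g); rewrite !eval_rename.
have vgf : {in variables e, v =1 (v \o g) \o f} by move=> i ie /=; rewrite fK.
by rewrite !(eval_congr vgf).
Qed.

Lemma CI_variety_rename (f g : nat -> nat) e :
  {in variables e, cancel f g} ->
  CI_variety (rename_identity f e) = CI_variety e.
Proof.
move=> fK; apply/seteqP; split=> G [CI sat]; split=> //.
  exact/(satisfies_rename G fK).
exact/(satisfies_rename G fK).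
Qed.

(** * Equality of identities modulo the CI laws and symmetries *)

(** Sound but incomplete tests: they only undo commutations of subterms and
    contract visible squares, which suffices for bracketings of four letters. *)
Fixpoint comm_eq (s t : term) : bool :=
  match s, t with
  | Var i, Var j => i == j
  | s1 ∘ s2, t1 ∘ t2 =>
      comm_eq s1 t1 && comm_eq s2 t2 || comm_eq s1 t2 && comm_eq s2 t1
  | _, _ => false
  end.

Fixpoint contract (t : term) : term :=
  match t with
  | Var i => Var i
  | t1 ∘ t2 =>
      let u1 := contract t1 in
      let u2 := contract t2 in
      if comm_eq u1 u2 then u1 else u1 ∘ u2
  end.

Definition CI_eq (s t : term) : bool := comm_eq (contract s) (contract t).

Definition swap12 : nat -> nat := nth 0 [:: 0; 2; 1].

Definition same_sides (e r : identity) : bool :=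
  CI_eq e.1 r.1 && CI_eq e.2 r.2 || CI_eq e.1 r.2 && CI_eq e.2 r.1.

Definition same_law (e r : identity) : bool :=
  same_sides e r || same_sides (rename_identity swap12 e) r.

Lemma comm_eq_eval (G : groupoid) (v : nat -> G) s t :
  CI_groupoid G -> comm_eq s t -> eval v s = eval v t.
Proof.
move=> [opC _]; elim: s t => [i|s1 IH1 s2 IH2] [j|t1 t2] //= => [/eqP->//|].
by case/orP=> /andP[/IH1-> /IH2->].
Qed.

Lemma contract_eval (G : groupoid) (v : nat -> G) t :
  CI_groupoid G -> eval v (contract t) = eval v t.
Proof.
move=> CI; elim: t => //= t1 <- t2 <-.
by case: ifP => // /(comm_eq_eval v CI) <-; rewrite CI.2.
Qed.

Lemma CI_eq_eval (G : groupoid) (v : nat -> G) s t :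
  CI_groupoid G -> CI_eq s t -> eval v s = eval v t.
Proof.
by move=> CI /(comm_eq_eval v CI); rewrite !contract_eval.
Qed.

Lemma same_sides_variety e r : same_sides e r -> CI_variety e = CI_variety r.
Proof.
move=> er; apply/seteqP; split=> G [CI sat]; split=> // v; have := sat v.
  by case/orP: er => /andP[/(CI_eq_eval v CI)-> /(CI_eq_eval v CI)->].
by case/orP: er => /andP[/(CI_eq_eval v CI)-> /(CI_eq_eval v CI)->].
Qed.

Lemma same_law_variety e r :
  {subset variables e <= [:: 0; 1; 2]} ->
  same_law e r -> CI_variety e = CI_variety r.
Proof.
move=> e012 /orP[/same_sides_variety//|/same_sides_variety <-].
rewrite (@CI_variety_rename swap12 swap12) // => i /e012.
by rewrite !inE => /or3P[] /eqP->.
Qed.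

(** * The list of Bol-Moufang identities *)

Definition bracketings (w : seq nat) : seq term :=
  if w is [:: i; j; k; l] then
    let: (a, b, c, d) := (Var i, Var j, Var k, Var l) in
    [:: a ∘ (b ∘ (c ∘ d)); a ∘ ((b ∘ c) ∘ d); (a ∘ b) ∘ (c ∘ d);
        (a ∘ (b ∘ c)) ∘ d; ((a ∘ b) ∘ c) ∘ d]
  else [::].

Definition bol_moufang_words : seq (seq nat) := permutations [:: 0; 0; 1; 2].

Definition bol_moufang_list : seq identity :=
  flatten [seq [seq (p, q) | p <- bracketings w, q <- bracketings w]
          | w <- bol_moufang_words].

Lemma word_neq0 t : word t <> [::].
Proof. by elim: t => //= t1; case: (word t1). Qed.

Lemma word1 t i : word t = [:: i] -> t = Var i.
Proof.
case: t => [j [->]//|t1 t2] /=.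
move: (@word_neq0 t1) (@word_neq0 t2).
by case: (word t1) => [|? []] //=; case: (word t2).
Qed.

Lemma word2 t i j : word t = [:: i; j] -> t = Var i ∘ Var j.
Proof.
case: t => //= t1 t2; move: (@word_neq0 t1) (@word_neq0 t2).
case E1: (word t1) => [|a [|b []]] //=; case E2: (word t2) => [|c u] //= _ _.
by case=> <- ? ?; subst; rewrite (word1 E1) (word1 E2).
Qed.

Lemma word3 t i j k : word t = [:: i; j; k] ->
  t = Var i ∘ (Var j ∘ Var k) \/ t = (Var i ∘ Var j) ∘ Var k.
Proof.
case: t => //= t1 t2; move: (@word_neq0 t1) (@word_neq0 t2).
case E1: (word t1) => [|a [|b [|c []]]] //=;
  case E2: (word t2) => [|d u] //= _ _ [] *; subst.
  by left; rewrite (word1 E1) (word2 E2).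
by right; rewrite (word2 E1) (word1 E2).
Qed.

Lemma mem_bracketings t w :
  size w = 4 -> word t = w -> t \in bracketings w.
Proof.
case: w => [|i [|j [|k [|l []]]]] //= _.
case: t => //= t1 t2; move: (@word_neq0 t1) (@word_neq0 t2).
case E1: (word t1) => [|a [|b [|c [|d []]]]] //=;
  case E2: (word t2) => [|d' u] //= _ _ [] *; subst.
- by rewrite (word1 E1); case: (word3 E2) => ->; rewrite !inE eqxx ?orbT.
- by rewrite (word2 E1) (word2 E2) !inE eqxx ?orbT.
- by rewrite (word1 E2); case: (word3 E1) => ->; rewrite !inE eqxx ?orbT.
Qed.

(** Mapping the repeated variable to 0 and the others to 1 and 2 makes the
    common word a permutation of 0012, and a term is determined by its word and
    its bracketing. *)
Lemma bol_moufang_renamed e : bol_moufang e ->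
  exists f g, {in variables e, cancel f g} /\
              rename_identity f e \in bol_moufang_list.
Proof.
case=> x [y [z [xyz [e1E e2E] [cx1 cx2] [cy1 cz1 cy2 cz2] e12]]].
pose f i := index i [:: x; y; z]; exists f, (nth x [:: x; y; z]); split.
  by move=> i; rewrite mem_cat e1E e2E orbb => /nth_index.
have fword : map f (word e.1) \in bol_moufang_words.
  have fE : [:: 0; 0; 1; 2] = map f [:: x; x; y; z].
    move: xyz; rewrite /= !inE negb_or andbT => /andP[/andP[xy xz] yz].
    by rewrite /f /= !eqxx (negPf xy) (negPf xz) (negPf yz).
  rewrite mem_permutations fE; apply: perm_map; apply/allP => i.
  move: xyz; rewrite /= !inE negb_or andbT => /andP[/andP[xy xz] yz].
  have ixyz : i \in word e.1 ++ [:: x; x; y; z] -> i \in [:: x; y; z].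
    by rewrite mem_cat e1E !inE; do 3!case: eqP.
  move=> /ixyz; rewrite !inE => /or3P[] /eqP->; rewrite ?cx1 ?cy1 ?cz1.
  - by rewrite eqxx (eq_sym y) (eq_sym z) (negPf xy) (negPf xz).
  - by rewrite eqxx (eq_sym z) (negPf xy) (negPf yz).
  - by rewrite eqxx (negPf xz) (negPf yz).
have size4 : size (map f (word e.1)) = 4.
  by move: fword; rewrite mem_permutations => /perm_size.
apply/flatten_mapP; exists (map f (word e.1)) => //.
by apply: allpairs_f; apply: mem_bracketings; rewrite ?word_rename -?e12.
Qed.

(** * Consequences of the Bol-Moufang laws *)

(** Each row collects laws that define the same variety of CI-groupoids; its
    first entry represents it.  The laws are written with their squares
    [X ∘ X] and with equal words on both sides, so that each is of Bol-Moufang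
    type and holds in every semigroup. *)
Definition classification : seq (seq identity) :=
  [:: [seq (t, t) | t <- [:: X ∘ (X ∘ (Y ∘ Z)); X ∘ ((X ∘ Y) ∘ Z);
                             (X ∘ X) ∘ (Y ∘ Z); (X ∘ (X ∘ Y)) ∘ Z;
                             ((X ∘ X) ∘ Y) ∘ Z; (X ∘ Y) ∘ (X ∘ Z)]];
      [:: ((X ∘ X) ∘ (Y ∘ Z), ((X ∘ X) ∘ Y) ∘ Z);
          (X ∘ (X ∘ (Y ∘ Z)), X ∘ ((X ∘ Y) ∘ Z));
          (X ∘ (X ∘ (Y ∘ Z)), ((X ∘ X) ∘ Y) ∘ Z);
          (X ∘ ((X ∘ Y) ∘ Z), (X ∘ X) ∘ (Y ∘ Z));
          ((X ∘ X) ∘ (Y ∘ Z), (X ∘ (X ∘ Y)) ∘ Z);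
          (X ∘ (Y ∘ (X ∘ Z)), (X ∘ (Y ∘ X)) ∘ Z);
          ((X ∘ (Y ∘ X)) ∘ Z, (X ∘ Y) ∘ (X ∘ Z));
          (X ∘ ((Y ∘ Z) ∘ X), (X ∘ Y) ∘ (Z ∘ X));
          (((Y ∘ X) ∘ X) ∘ Z, Y ∘ ((X ∘ X) ∘ Z));
          ((Y ∘ (X ∘ X)) ∘ Z, (Y ∘ X) ∘ (X ∘ Z));
          ((Y ∘ (X ∘ X)) ∘ Z, Y ∘ ((X ∘ X) ∘ Z))];
      [:: (X ∘ ((X ∘ Y) ∘ Z), (X ∘ (X ∘ Y)) ∘ Z);
          (X ∘ ((X ∘ Y) ∘ Z), ((X ∘ X) ∘ Y) ∘ Z)];
      [:: (X ∘ (X ∘ (Y ∘ Z)), (X ∘ (X ∘ Y)) ∘ Z)];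
      [:: (((Y ∘ X) ∘ X) ∘ Z, Y ∘ (X ∘ (X ∘ Z)))];
      [:: (X ∘ ((Y ∘ X) ∘ Z), (X ∘ Y) ∘ (X ∘ Z))];
      [:: (X ∘ (Y ∘ (X ∘ Z)), X ∘ ((Y ∘ X) ∘ Z))];
      [:: (X ∘ (X ∘ (Y ∘ Z)), (X ∘ X) ∘ (Y ∘ Z));
          ((X ∘ (X ∘ Y)) ∘ Z, ((X ∘ X) ∘ Y) ∘ Z)]].

Definition row (i : nat) : seq identity := nth [::] classification i.
Definition representative (i : nat) : identity := head (X, X) (row i).

Lemma classified e : e \in bol_moufang_list ->
  {subset variables e <= [:: 0; 1; 2]} /\
  has (fun i => has (same_law e) (row i)) (iota 0 8).
Proof.
move=> eL; pose ok e :=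
  all (mem [:: 0; 1; 2]) (variables e) &&
  has (fun i => has (same_law e) (row i)) (iota 0 8).
have /allP/(_ e eL)/andP[/allP] : all ok bol_moufang_list by vm_compute.
by [].
Qed.

Lemma representative_bol_moufang i : i < 8 -> bol_moufang (representative i).
Proof.
move=> lti8; suff [w12 /perm_mem wE wc] :
    [/\ word (representative i).1 = word (representative i).2,
        perm_eq (word (representative i).1) [:: 0; 0; 1; 2] &
        [/\ count_mem 0 (word (representative i).1) = 2,
            count_mem 1 (word (representative i).1) = 1 &
            count_mem 2 (word (representative i).1) = 1]].
  have wE3 : word (representative i).1 =i [:: 0; 1; 2].
    by move=> j; rewrite wE !inE orbA orbb.
  by case: wc => c0 c1 c2; exists 0, 1, 2; split; rewrite -?w12.
by move: i lti8; do 8!case=> //.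
Qed.

(** The laws are named after their two sides, with squares contracted and up to
    commutativity and exchange of y and z:
    A is x(x(yz)), B is x((xy)z), C is x(yz), D is (x(xy))z, E is (xy)z and
    F is (xy)(xz). *)
Section Laws.
Variables (T : Type) (m : T -> T -> T).
Local Notation "x * y" := (m x y).
Hypotheses (mC : commutative m) (mI : idempotent_op m).

Lemma assoc_of_right_comm :
  (forall x y z, (x * y) * z = (x * z) * y) -> associative m.
Proof. by move=> H x y z; rewrite mC H (mC y). Qed.

(** The right-hand side is symmetric in y and z. *)
Lemma assoc_of_distributive :
  (forall x y z, (x * y) * z = (x * y) * (x * z)) -> associative m.
Proof.
by move=> H; apply: assoc_of_right_comm => x y z; rewrite H [RHS]H mC.
Qed.

Definition two_semilattice := forall x y, x * (x * y) = x * y.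

(** Putting z = xy gives x(xy) = xy.  Then with a = xy one has ax = a, and
    the law applied to a, x, z reads a(az) = a(xz), that is az = a(xz). *)
Lemma assoc_of_BC :
  (forall x y z, x * ((x * y) * z) = x * (y * z)) -> associative m.
Proof.
move=> H.
have m2 : two_semilattice.
  by move=> x y; have := H x y (x * y); rewrite mI => ->; rewrite (mC y) H mI.
apply: assoc_of_distributive => x y z.
by rewrite -[RHS]H (mC _ x) m2 m2.
Qed.

(** Only x(xy) = xy is missing, as then the law reduces to B = C.  With a = xy
    and b = xa, the law gives ba = a, hence b(b(yx)) = a; but it
    also gives b(b(yx)) = b((by)x) = b, because (by)x = b. *)
Lemma assoc_of_AB :
  (forall x y z, x * (x * (y * z)) = x * ((x * y) * z)) -> associative m.
Proof.
move=> H.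
have xc x y : x * (y * (x * y)) = x * (x * y) by rewrite (mC y) -H mI.
have ab x y : (x * y) * (x * (x * y)) = x * y.
  have <- : ((x * y) * y) * x = x * (x * y) by rewrite (mC (x * y * y)) (mC _ y) xc.
  by rewrite -H (mC y) !mI.
suff m2 : two_semilattice.
  by apply: assoc_of_BC => x y z; rewrite -H m2.
move=> x y; set a := x * y; set b := x * a.
have ba : b * a = a by rewrite mC ab.
have byx : b * y = y * a by rewrite mC /b /a (mC x y) xc.
have : b * (b * (y * x)) = b.
  by rewrite H byx (mC _ x) [x * _]xc mI.
by rewrite (mC y) ba ba.
Qed.

Lemma assoc_of_CD :
  (forall x y z, x * (y * z) = (x * (x * y)) * z) -> associative m.
Proof.
move=> H; have m2 : two_semilattice by move=> x y; rewrite H !mI.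
by move=> x y z; rewrite H m2.
Qed.

Lemma assoc_of_AE :
  (forall x y z, x * (x * (y * z)) = (x * y) * z) -> associative m.
Proof. by move=> H; apply: assoc_of_right_comm => x y z; rewrite -H (mC y) H. Qed.

(** In the presence of x(xy) = xy, the law distributes every left
    multiplication over the product; multiplication by xy sends x to xy. *)
Lemma assoc_of_AF :
  (forall x y z, x * (x * (y * z)) = (x * y) * (x * z)) -> associative m.
Proof.
move=> H; have m2 : two_semilattice by move=> x y; have := H x y y; rewrite !mI.
apply: assoc_of_distributive => x y z.
by rewrite -[RHS]m2 H (mC _ x) !m2.
Qed.

Lemma assoc_of_BD :
  (forall x y z, x * (y * (x * z)) = (x * (x * y)) * z) -> associative m.
Proof.
move=> H.
have m2 : two_semilattice.
  (* Left multiplication L by x satisfies L^3 = L (the case y = x)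
     and L^2 = L^3 (the case z = x). *)
  move=> x y; have xxx : x * (x * (x * y)) = x * y by rewrite H !mI.
  by rewrite -[RHS]xxx; have := H x y x; rewrite mI (mC y) (mC (x * (x * y))).
have {}H x y z : x * (y * (x * z)) = (x * y) * z by rewrite H m2.
by apply: assoc_of_right_comm => x y z; rewrite -[RHS]H (mC z) -[in RHS]H m2 H.
Qed.

Lemma assoc_of_DF :
  (forall x y z, (x * (x * y)) * z = (x * y) * (x * z)) -> associative m.
Proof.
move=> H.
have m2 : two_semilattice by move=> x y; have := H x x y; rewrite !mI.
by apply: assoc_of_distributive => x y z; rewrite -H m2.
Qed.

Lemma assoc_of_DE :
  (forall x y z, (x * (x * y)) * z = y * (x * z)) -> associative m.
Proof.
move=> H.
have m2 : two_semilattice by move=> x y; rewrite -H !mI.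
by apply: assoc_of_right_comm => x y z; rewrite (mC (x * z)) -H m2.
Qed.
End Laws.

Lemma satisfies_xyz (G : groupoid) e : satisfies G e ->
  forall x y z : G, eval (nth x [:: x; y; z]) e.1 = eval (nth x [:: x; y; z]) e.2.
Proof. by move=> sat x y z; apply: sat. Qed.

(** In a semigroup the value of a term depends only on its word. *)
Lemma eval_assoc (G : groupoid) (v : nat -> G) s t :
  associative (@op G) -> word s = word t -> eval v s = eval v t.
Proof.
move=> opA.
pose prod (w : seq nat) := if w is i :: w' then foldl (fun a j => op a (v j)) (v i) w'
                          else v 0.
have evalE u a : foldl (fun a j => op a (v j)) a (word u) = op a (eval v u).
  by elim: u a => //= u1 IH1 u2 IH2 a; rewrite foldl_cat IH1 IH2 opA.
suff prodE u : eval v u = prod (word u) by rewrite !prodE => ->.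
elim: u => //= u1 IH1 u2 _; case E: (word u1) IH1 => [|i w] IH1.
  by case: (word_neq0 E).
by rewrite /= foldl_cat -/(prod (i :: w)) -IH1 evalE.
Qed.

Lemma associativity_laws (G : groupoid) r : CI_groupoid G -> r \in row 1 ->
  satisfies G r <-> associative (@op G).
Proof.
move=> [mC mI] r1; split; last first.
  move=> opA v; apply: eval_assoc => //; apply/eqP; move: r r1.
  by apply/allP.
move=> /satisfies_xyz sat; move: r1; rewrite /row /= !inE.
case/or4P=> [/eqP|/eqP|/eqP|/or4P[/eqP|/eqP|/eqP|/or4P[/eqP|/eqP|/eqP|/orP[]/eqP]]] rE;
  rewrite {}rE /= in sat.
- by move=> x y z; have := sat x y z; rewrite !mI.
- exact: assoc_of_AB.
- by apply: assoc_of_AE => // x y z; rewrite sat mI.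
- by apply: assoc_of_BC => // x y z; rewrite sat mI.
- by apply: assoc_of_CD => // x y z; rewrite -sat mI.
- by apply: assoc_of_BD => // x y z; rewrite sat (mC y).
- by apply: assoc_of_DF => // x y z; rewrite -sat (mC y).
- by apply: assoc_of_AF => // x y z; rewrite (mC x z) -sat (mC (op y z)).
- by apply: assoc_of_DE => // x y z; have := sat x y z;
  rewrite mI (mC y x) (mC (op x y)).
- by apply: assoc_of_distributive => // x y z; have := sat x y z; rewrite mI (mC y).
- apply: assoc_of_right_comm => // x y z; have := sat x y z; rewrite !mI => E.
  by rewrite (mC x y) E mC.
Qed.

Lemma two_semilattice_laws (G : groupoid) r : CI_groupoid G -> r \in row 7 ->
  satisfies G r <-> two_semilattice (@op G).
Proof.
move=> [mC mI]; rewrite /row /= !inE => /orP[] /eqP->;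
  split=> [/satisfies_xyz sat x y|m2 v] /=.
- by have := sat x y y; rewrite /= !mI.
- by rewrite m2 mI.
(* With a = xy and b = xa, the cases z = a and z = b give ba = a and b = ab. *)
- have := sat x y (op x y); have := sat x y (op x (op x y)).
  by rewrite /= !mI => bE ba; rewrite bE mC.
- by rewrite m2 mI.
Qed.

(** Both laws contain x(xz) = xz as the case y = x, and modulo this one they
    coincide. *)
Lemma mixed_laws (G : groupoid) r : CI_groupoid G -> r \in row 2 ->
  satisfies G r <->
  two_semilattice (@op G) /\
  forall x y z : G, op x (op (op x y) z) = op (op x y) z.
Proof.
move=> [mC mI]; rewrite /row /= !inE => /orP[] /eqP->;
  split=> [/satisfies_xyz sat|[m2 H] v] /=.
- have m2 : two_semilattice (@op G) by move=> x z; have := sat x x z; rewrite /= !mI.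
  by split=> // x y z; have := sat x y z; rewrite /= m2.
- by rewrite H m2.
- have m2 : two_semilattice (@op G) by move=> x z; have := sat x x z; rewrite /= !mI.
  by split=> // x y z; have := sat x y z; rewrite /= mI.
- by rewrite H mI.
Qed.

Lemma row_variety i r : i < 8 -> r \in row i ->
  CI_variety r = CI_variety (representative i).
Proof.
move=> lti8 ri.
suff sat_rep G : CI_groupoid G -> satisfies G r <-> satisfies G (representative i).
  by apply/seteqP; split=> G [CI sat]; split=> //; apply/(sat_rep G CI).
have repi : representative i \in row i.
  by move: ri; rewrite /representative; case: (row i) => //= *; apply: mem_head.
move=> CI; case: i lti8 ri repi => [|[|[|[|[|[|[|[|//]]]]]]]] _ ri repi.
- have triv e : e \in row 0 -> satisfies G e by case/mapP=> t _ -> v.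
  by split=> _; apply: triv.
- by rewrite !associativity_laws.
- by rewrite !mixed_laws.
- by move: ri; rewrite inE => /eqP->.
- by move: ri; rewrite inE => /eqP->.
- by move: ri; rewrite inE => /eqP->.
- by move: ri; rewrite inE => /eqP->.
- by rewrite !two_semilattice_laws.
Qed.

(** * Finite CI-groupoids that separate the varieties *)

Definition table_op (t : seq (seq nat)) (i j : nat) : nat := nth 0 (nth [::] t i) j.

(** The carrier is a subset of nat rather than an ordinal type: the universe of
    the latter is too large for [groupoid].  The default value [i] of [insubd]
    is never reached for a table that passes [table_CI]. *)
Definition table_groupoid (t : seq (seq nat)) : groupoid :=
  @Groupoid {i : nat | i < size t} (fun i j => insubd i (table_op t (val i) (val j))).

Definition table_CI (t : seq (seq nat)) : bool :=
  let s := iota 0 (size t) in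
  all (fun i => all (fun j => [&& table_op t i j < size t,
    table_op t i j == table_op t j i & table_op t i i == i]) s) s.

Definition table_satisfies (t : seq (seq nat)) (e : identity) : bool :=
  let s := iota 0 (size t) in
  let holds_at i j k :=
    let v := nth 0 [:: i; j; k] in
    @eval (Groupoid (table_op t)) v e.1 == @eval (Groupoid (table_op t)) v e.2 in
  all (fun i => all (fun j => all (holds_at i j) s) s) s.

Lemma mem_iota_sig n (i : {i | i < n}) : val i \in iota 0 n.
Proof. by rewrite mem_iota (valP i). Qed.

(** The operation of a table extends to all of nat by default values, and it is
    on nat, where evaluation computes, that identities are tested. *)
Section Table.
Variable t : seq (seq nat).
Hypothesis tCI : table_CI t.
Let G := table_groupoid t.

Lemma table_CIP (i j : G) :
  let i' := val i in let j' := val j in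
  [/\ table_op t i' j' < size t, table_op t i' j' = table_op t j' i' &
      table_op t i' i' = i'].
Proof.
move/allP: tCI => /(_ _ (mem_iota_sig i)) /allP/(_ _ (mem_iota_sig j)).
by case/and3P=> ? /eqP ? /eqP.
Qed.

Lemma table_CI_groupoid : CI_groupoid G.
Proof.
split=> [i j|i]; apply: val_inj; rewrite /= !val_insubd.
  by have [ltij ijC _] := table_CIP i j; rewrite -ijC ltij.
by have [ltii _ iiI] := table_CIP i i; rewrite ltii.
Qed.

Lemma val_table_eval (v : nat -> G) s :
  val (eval v s) = @eval (Groupoid (table_op t)) (val \o v) s.
Proof.
elim: s => //= s1 <- s2 <-; rewrite val_insubd.
by have [->] := table_CIP (eval v s1) (eval v s2).
Qed.

Lemma table_satisfiesP e : {subset variables e <= [:: 0; 1; 2]} ->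
  satisfies G e <-> table_satisfies t e.
Proof.
move=> e012; split=> [sat|/allP sat v].
  apply/allP=> i; rewrite mem_iota => /= ltin.
  apply/allP=> j; rewrite mem_iota => /= ltjn.
  apply/allP=> k; rewrite mem_iota => /= ltkn; apply/eqP.
  pose ltT i : Prop := i < size t.
  pose v : nat -> G :=
    nth (exist ltT i ltin) [:: exist ltT i ltin; exist ltT j ltjn; exist ltT k ltkn].
  have vE : {in variables e, nth 0 [:: i; j; k] =1 val \o v}.
    by move=> l /e012; rewrite !inE => /or3P[] /eqP->.
  have /(congr1 val) := sat v; rewrite !val_table_eval.
  by rewrite !(@eval_congr (Groupoid (table_op t)) _ _ _ vE).
apply: val_inj; rewrite !val_table_eval.
move: (sat _ (mem_iota_sig (v 0))) => /allP/(_ _ (mem_iota_sig (v 1))).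
move=> /allP/(_ _ (mem_iota_sig (v 2)))/eqP.
have vE : {in variables e, nth 0 [:: val (v 0); val (v 1); val (v 2)] =1 val \o v}.
  by move=> l /e012; rewrite !inE => /or3P[] /eqP->.
by rewrite !(@eval_congr (Groupoid (table_op t)) _ _ _ vE).
Qed.

End Table.

(** In order, with the rows other than row 0 whose laws they satisfy:
    - rows 3 and 4: the operation -x-y on Z/3;
    - row 7: rock-paper-scissors;
    - rows 5 and 6: the mean on {0, 1, 2}, rounded away from 1;
    - rows 2 and 7: 0 absorbs, 1 and 2 have product 0, and each has product 3
      with 3;
    - row 6: distinct elements have product 0, except that 2 and 3 have product 1;
    - row 4: {0, 4, 5} and {1, 2, 3} are copies of the first groupoid, and i in
      the second acts on the first as f(i), where f(1) = f(3) = 0 and f(2) = 5.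
      If f were a homomorphism, this would be a Plonka sum and satisfy the laws
      of row 3 as well. *)
Definition separating_tables : seq (seq (seq nat)) :=
  [:: [:: [:: 0; 2; 1]; [:: 2; 1; 0]; [:: 1; 0; 2]];
      [:: [:: 0; 0; 2]; [:: 0; 1; 1]; [:: 2; 1; 2]];
      [:: [:: 0; 0; 1]; [:: 0; 1; 2]; [:: 1; 2; 2]];
      [:: [:: 0; 0; 0; 0]; [:: 0; 1; 0; 3]; [:: 0; 0; 2; 3]; [:: 0; 3; 3; 3]];
      [:: [:: 0; 0; 0; 0]; [:: 0; 1; 0; 0]; [:: 0; 0; 2; 1]; [:: 0; 0; 1; 3]];
      [:: [:: 0; 0; 4; 0; 5; 4]; [:: 0; 1; 3; 2; 5; 4]; [:: 4; 3; 2; 1; 0; 5];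
          [:: 0; 2; 1; 3; 5; 4]; [:: 5; 5; 0; 5; 4; 0]; [:: 4; 4; 5; 4; 0; 5]]].

Lemma classification_separated :
  {in gtn 8 &, injective (fun i => CI_variety (representative i))}.
Proof.
move=> i j lti8 ltj8 /= eqV.
have vars k : k < 8 -> {subset variables (representative k) <= [:: 0; 1; 2]}.
  by move=> ltk8; apply/allP; move: k ltk8; do 8!case=> //.
have tV k t : k < 8 -> table_CI t ->
    CI_variety (representative k) (table_groupoid t) <->
    table_satisfies t (representative k).
  move=> ltk8 tCI; rewrite -(table_satisfiesP tCI (vars k ltk8)).
  by split=> [[]//|]; split=> //; apply: table_CI_groupoid.
have eqT : all (fun t => table_satisfies t (representative i) ==
                         table_satisfies t (representative j)) separating_tables.
  apply/allP=> t tL.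
  have tCI : table_CI t by move: t tL; apply/allP; vm_compute.
  apply/eqP; apply/idP/idP.
    by move/(tV i t lti8 tCI); rewrite eqV => /(tV j t ltj8 tCI).
  by move/(tV j t ltj8 tCI); rewrite -eqV => /(tV i t lti8 tCI).
pose sep i j := all (fun t => table_satisfies t (representative i) ==
  table_satisfies t (representative j)) separating_tables ==> (i == j).
have /allP/(_ i) : all (fun i => all (sep i) (iota 0 8)) (iota 0 8) by vm_compute.
rewrite mem_iota => /(_ lti8)/allP/(_ j); rewrite mem_iota => /(_ ltj8).
by rewrite /sep eqT => /eqP.
Qed.

Theorem mainTheorem1 : (CI_varieties_bol_moufang #= `I_8)%card.
Proof.
have -> : CI_varieties_bol_moufang =
    [set CI_variety (representative i) | i in `I_8]%classic.
  apply/seteqP; split=> [_ [e eBM <-]|_ [i lti8 <-]]; last first.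
    by exists (representative i) => //; apply: representative_bol_moufang.
  have [f [g [fK feL]]] := bol_moufang_renamed eBM.
  have [fe012 /hasP[i]] := classified feL.
  rewrite mem_iota => lti8 /hasP[r ri same]; exists i => //.
  by rewrite -(row_variety lti8 ri) -(same_law_variety fe012 same)
     (CI_variety_rename fK).
apply: inj_card_eq => i j /set_mem lti8 /set_mem ltj8.
exact: classification_separated.
Qed.
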